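(* Let $\mathcal{I}$ be a Borel ideal on $\omega$. The following are equivalent: (1) $\mathcal{I}\text{-}LIM(\mathcal{QC}(X))=LIM(\mathcal{QC}(X))$ for every metrizable Baire space $X$; (2) $\mathcal{I}$ is weakly Ramsey; (3) $\mathcal{WR}\not\leq_K\mathcal{I}$; (4) $\mathcal{WR}\not\sqsubseteq\mathcal{I}$.
   Context: An ideal on a countable set $Y$ is a collection $\mathcal{I}\subset\mathcal{P}(Y)$ closed under subsets and finite unions, with $\mathcal{I}\neq\mathcal{P}(Y)$ and containing all finite subsets of $Y$. $\mathcal{I}$ is Borel if it is a Borel subset of $\mathcal{P}(Y)$ identified with $2^Y$ with the product topology. $\mathcal{I}^*=\{A\subset Y: Y\setminus A\in\mathcal{I}\}$; a set $A\subset Y$ is $\mathcal{I}$-positive if $A\notin\mathcal{I}$. A family $\mathcal{G}$ generates $\mathcal{I}$ if $\mathcal{I}$ consists of all sets covered by finitely many members of $\mathcal{G}$. $\mathcal{WR}$ is the ideal on $\omega\times\omega$ generated by the vertical lines $\{n\}\times\omega$, $n\in\omega$, together with all sets $G\subset\omega\times\omega$ such that for every two distinct points $(i,j),(k,l)\in G$ either $i>k+l$ or $k>i+j$. $\mathcal{I}\leq_K\mathcal{J}$ if there is a function $f:\bigcup\mathcal{J}\to\bigcup\mathcal{I}$ such that $A\in\mathcal{I}$ implies $f^{-1}[A]\in\mathcal{J}$. $\mathcal{I}\sqsubseteq\mathcal{J}$ if there is such an $f$ which is a bijection. A tree is a nonempty set $T\subset Y^{<\omega}$ of finite sequences closed under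 initial segments. The ramification of $T$ at $s\in T$ is $\{y\in Y: s^\frown(y)\in T\}$. A branch of $T$ is a function $b:\omega\to Y$ with $(b(0),\ldots,b(k))\in T$ for all $k$; it is $\mathcal{I}$-positive if $b[\omega]\notin\mathcal{I}$. An ideal $\mathcal{I}$ on $Y$ is weakly Ramsey if every tree $T\subset Y^{<\omega}$ with all ramifications in $\mathcal{I}^*$ has an $\mathcal{I}$-positive branch. For an ideal $\mathcal{I}$ on $\omega$, a sequence of reals $(x_i)_{i\in\omega}$ is $\mathcal{I}$-convergent to $x\in\mathbb{R}$ if $\{i\in\omega:|x_i-x|\geq\epsilon\}\in\mathcal{I}$ for every $\epsilon>0$. A function $f:X\to\mathbb{R}$ is a pointwise $\mathcal{I}$-limit of a sequence of functions $(f_i)_{i\in\omega}$ if $(f_i(x))_{i\in\omega}$ is $\mathcal{I}$-convergent to $f(x)$ for every $x\in X$. For a family $\mathcal{F}$ of real-valued functions on $X$, $LIM(\mathcal{F})$ (respectively $\mathcal{I}\text{-}LIM(\mathcal{F})$) is the family of all functions which are pointwise limits (respectively pointwise $\mathcal{I}$-limits) of sequences of functions from $\mathcal{F}$. A function $f:X\to\mathbb{R}$ on a topological space $X$ is quasi-continuous if for all $\epsilon>0$, $x_0\in X$ and every open neighborhood $U\ni x_0$ there is a nonempty open $V\subset U$ such that $|f(x)-f(x_0)|<\epsilon$ for all $x\in V$. $\mathcal{QC}(X)$ is the family of all real-valued quasi-continuous functions on $X$. *)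

(* Defs.v *)
From HB Require Import structures.
From mathcomp Require Import all_boot all_order all_algebra.
From mathcomp Require Import all_classical all_reals all_analysis.

Set Implicit Arguments.
Unset Strict Implicit.
Unset Printing Implicit Defensive.

Import Order.TTheory GRing.Theory Num.Theory.
Import numFieldNormedType.Exports.

Local Open Scope classical_set_scope.
Local Open Scope ring_scope.

Record is_ideal (Y : Type) (I : set (set Y)) : Prop := IsIdeal {
  ideal_sub : forall A B : set Y, A `<=` B -> I B -> I A;
  ideal_setU : forall A B : set Y, I A -> I B -> I (A `|` B);
  ideal_proper : ~ I setT;
  ideal_finite : forall A : set Y, finite_set A -> I A }.

(* Subsets of nat are coded by points of 2^nat; [cantor_space] carries the
   product of the discrete topologies on bool. *)
Definition borel_ideal (I : set (set nat)) : Prop :=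
  <<s @open cantor_space >> [set x : cantor_space | I [set n | x n]].

Definition dual_filter (Y : Type) (I : set (set Y)) : set (set Y) :=
  [set A | I (~` A)].

Definition generated_ideal (Y : Type) (G : set (set Y)) : set (set Y) :=
  [set A | exists F : set (set Y),
     [/\ finite_set F, F `<=` G & A `<=` \bigcup_(B in F) B]].

Definition vertical_line (n : nat) : set (nat * nat) :=
  [set p | p.1 = n].

Definition WR_sparse (G : set (nat * nat)) : Prop :=
  forall p q : nat * nat, G p -> G q -> p <> q ->
    (q.1 + q.2 < p.1)%N \/ (p.1 + p.2 < q.1)%N.

Definition WR : set (set (nat * nat)) :=
  generated_ideal (range vertical_line `|` [set G | WR_sparse G]).

(* An ideal contains every finite set, so its union is the whole carrier. *)
Definition katetov_le (Y Z : Type) (I : set (set Y)) (J : set (set Z)) : Prop :=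
  exists f : Z -> Y, forall A : set Y, I A -> J (f @^-1` A).

Definition bij_le (Y Z : Type) (I : set (set Y)) (J : set (set Z)) : Prop :=
  exists2 f : Z -> Y, bijective f & forall A : set Y, I A -> J (f @^-1` A).

Definition is_tree (Y : Type) (T : set (seq Y)) : Prop :=
  T !=set0 /\ forall s t : seq Y, T (s ++ t) -> T s.

Definition ramification (Y : Type) (T : set (seq Y)) (s : seq Y) : set Y :=
  [set y | T (rcons s y)].

Definition is_branch (Y : Type) (T : set (seq Y)) (b : nat -> Y) : Prop :=
  forall k : nat, T (mkseq b k.+1).

Definition weakly_Ramsey (Y : Type) (I : set (set Y)) : Prop :=
  forall T : set (seq Y), is_tree T ->
    (forall s, T s -> dual_filter I (ramification T s)) ->
    exists2 b : nat -> Y, is_branch T b & ~ I (range b).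

Definition ideal_cvg (R : realType) (I : set (set nat)) (u : nat -> R) (l : R)
    : Prop :=
  forall e : R, 0 < e -> I [set i | e <= `|u i - l|].

Definition LIM (R : realType) (X : Type) (F : set (X -> R)) : set (X -> R) :=
  [set f | exists2 g : nat -> X -> R,
     (forall i, F (g i)) & forall x, g i x @[i --> \oo] --> f x].

Definition ideal_LIM (R : realType) (I : set (set nat)) (X : Type)
    (F : set (X -> R)) : set (X -> R) :=
  [set f | exists2 g : nat -> X -> R,
     (forall i, F (g i)) & forall x, ideal_cvg I (fun i => g i x) (f x)].

Definition quasi_continuous (R : realType) (X : topologicalType) (f : X -> R)
    : Prop :=
  forall (e : R) (x0 : X) (U : set X), 0 < e -> open U -> U x0 ->
    exists V : set X, [/\ open V, V !=set0, V `<=` U &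
      forall x, V x -> `|f x - f x0| < e].

Definition QC (R : realType) (X : topologicalType) : set (X -> R) :=
  [set f | quasi_continuous f].
Arguments QC : clear implicits.

Definition is_metric (R : realType) (X : Type) (d : X -> X -> R) : Prop :=
  [/\ forall x y, 0 <= d x y,
      forall x y, d x y = 0 <-> x = y,
      forall x y, d x y = d y x &
      forall x y z, d x z <= d x y + d y z].

Definition metrizable (R : realType) (X : topologicalType) : Prop :=
  exists2 d : X -> X -> R, is_metric d &
    forall U : set X, open U <->
      forall x, U x -> exists2 e : R, 0 < e & [set y | d x y < e] `<=` U.

Definition baire_space (X : topologicalType) : Prop :=
  forall U : nat -> set X, (forall n, open (U n) /\ dense (U n)) ->
    dense (\bigcap_n U n).

(* Main.v *)
From HB Require Import structures.
Require Import Defs.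
From mathcomp Require Import all_boot all_order all_algebra.
From mathcomp Require Import all_classical all_reals all_analysis.
From mathcomp Require Import zify lra.

(** The implications are proved around the cycle, and three ideas carry them.

    The ideal WR is the least ideal that is not weakly Ramsey. In a tree with
    all ramifications in the dual filter and no positive branch, let the rank
    of k be the least n such that k escapes some ramification at a node of
    length at most n+1 with labels at most n (or k <= n). A sparse set pulled
    back by k |-> (rank k, k) can be listed, except for its points of rank 0,
    so that each point is outside everything that its predecessors could
    block; so it is a branch, and it lies in the ideal. This map is injective,
    and modifying it on an infinite set of the ideal makes it a bijection
    ([bij_le_WR_of_not_weakly_Ramsey]). Conversely, a reduction of WR gives
    the tree of all sequences with sparse image ([not_katetov_le_WR]).

    For a Borel ideal, being weakly Ramsey means that in the game where the
    first player plays sets A_n of the ideal, the second player picks k_n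
    outside A_n and tries to produce a positive set, the first player has no
    winning strategy. Borel determinacy would yield a winning strategy of the
    second player, but less suffices. A Borel ideal is analytic, and one
    requires the first player to build in addition a witness that the final
    set is in the ideal, which makes the game closed for him. Call a position
    solved if some countable family of positive sets has, for each set of the
    ideal with a witness compatible with the position, a member disjoint from
    that set. A position whose successors are solved for a positive set of
    answers to each digit of the witness is solved; hence the first player can
    keep an unsolved game unsolved, and wins. So for a weakly Ramsey ideal the
    initial position is solved ([weakly_Ramsey_pi_base]). Given such a family,
    if f is the ideal limit of quasi-continuous functions g_i on a Baire
    space, then every x has an index j with g_i(x) close to f(x) for all i in
    the j-th set; some j serves a somewhere dense set of points, and quasi-
    continuity spreads the estimate to an open set. So f is cliquish: it has
    small oscillation on some open part of every open set
    ([ideal_limit_cliquish]). On a metrizable space each cliquish function is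
    an ordinary limit of quasi-continuous functions ([cliquish_LIM]), which
    closes the equality of the two limit classes.

    If the ideal is not weakly Ramsey, it lies above WR, so one space on which
    WR adds a limit suffices. On sequences of pairs of numbers, each sequence
    records a sparse set in increasing order, possibly finite with arbitrarily
    long pauses; the characteristic function of the finite records is a WR
    limit of quasi-continuous functions, but is 0 and 1 on dense sets, so it
    is not cliquish ([hit_fun_cvg], [bounded_fun_not_cliquish]). *)

Set Implicit Arguments.
Unset Strict Implicit.
Unset Printing Implicit Defensive.

Import Order.TTheory GRing.Theory Num.Theory.
Import numFieldNormedType.Exports.

Local Open Scope classical_set_scope.
Local Open Scope ring_scope.

(** * Weakly Ramsey ideals and the ideal WR *)

Lemma ideal_bounded_union (Y : Type) (I : set (set Y)) (F : nat -> set Y) n :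
  is_ideal I ->
  (forall k, (k <= n)%N -> I (F k)) -> I [set x | exists2 k, (k <= n)%N & F k x].
Proof.
move=> idealI; elim: n => [|n IH] IF.
  apply: (ideal_sub idealI (B := F 0%N)); last exact: IF.
  by move=> x [k]; rewrite leqn0 => /eqP ->.
apply: (ideal_sub idealI (B := [set x | exists2 k, (k <= n)%N & F k x] `|` F n.+1)).
  move=> x [k]; rewrite leq_eqVlt ltnS => /predU1P[-> ?|]; first by right.
  by move=> kn Fx; left; exists k.
by apply: (ideal_setU idealI); [apply: IH => k kn; apply: IF; lia|exact: IF].
Qed.

Lemma ideal_bounded_seq_union (Y : Type) (I : set (set Y))
    (F : seq nat -> set Y) n m :
  is_ideal I -> (forall s, I (F s)) ->
  I [set x | exists s, [/\ (size s <= m)%N, all (leq^~ n) s & F s x]].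
Proof.
move=> idealI; elim: m F => [|m IH] F IF.
  by apply: (ideal_sub idealI (B := F [::])) => // x [[|a s] []].
pose G k : set Y :=
  [set x | exists s, [/\ (size s <= m)%N, all (leq^~ n) s & F (k :: s) x]].
apply: (ideal_sub idealI (B := F [::] `|` [set x | exists2 k, (k <= n)%N & G k x])).
  move=> x [[|k s] [/= sm]]; first by left.
  by move=> /andP[kn sn] Fx; right; exists k => //; exists s.
apply: (ideal_setU idealI) => //.
by apply: ideal_bounded_union => // k _; apply: (IH (fun s => F (k :: s))).
Qed.

Lemma WR_generated (Y : Type) (I : set (set Y)) (f : Y -> nat * nat) :
  is_ideal I ->
  (forall n, I (f @^-1` vertical_line n)) ->
  (forall G, WR_sparse G -> I (f @^-1` G)) ->
  forall A, WR A -> I (f @^-1` A).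
Proof.
move=> idealI fV fS A [F [/finite_seqP[s ->] sG AF]].
apply: (ideal_sub idealI (B := \bigcup_(B in [set` s]) f @^-1` B)).
  by move=> k /AF [B FB Bk]; exists B.
have {sG} : forall B, B \in s -> I (f @^-1` B).
  by move=> B /sG [[n _ <-]|]; [exact: fV|exact: fS].
elim: s {AF} => [|B s IH] Is.
  by apply: (ideal_sub idealI) (ideal_finite idealI (finite_set0 _)) => k [B].
have IB : I (f @^-1` B) by apply: Is; rewrite mem_head.
have /IH Irest : forall C, C \in s -> I (f @^-1` C).
  by move=> C Cs; apply: Is; rewrite in_cons Cs orbT.
apply: (ideal_sub idealI) (ideal_setU idealI IB Irest) => k [C /=].
by rewrite in_cons => /predU1P[->|Cs] Ck; [left|right; exists C].
Qed.

Section TreeToWR.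
Context (I : set (set nat)) (idealI : is_ideal I).

Variable T : set (seq nat).
Hypothesis treeT : is_tree T.
Hypothesis ramT : forall s, T s -> dual_filter I (ramification T s).
Hypothesis branchT : forall b, is_branch T b -> I (range b).

Lemma tree_nil : T [::].
Proof. by case: treeT => -[s Ts] pre; apply: (pre [::] s). Qed.

Lemma branch_of_prefixes b : (forall m, T (mkseq b m) -> T (rcons (mkseq b m) (b m)))
  -> is_branch T b.
Proof.
move=> step k.
suff Tb m : T (mkseq b m) by [].
by elim: m => [|m /step]; [exact: tree_nil|rewrite mkseqS].
Qed.

(** Ramifications are infinite, so a branch can be chosen strictly increasing;
    its range is in the ideal since no branch is positive. *)
Lemma tree_infinite_set : exists2 B, infinite_set B & I B.
Proof.
have ext s : exists k, T s -> T (rcons s k) /\ all (ltn^~ k) s.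
  have [Ts|] := pselect (T s); last by exists 0%N.
  apply: contrapT => /forallNP nk; apply: (ideal_proper idealI).
  pose n := \max_(i <- s) i.
  have ns : all (leq^~ n) s by apply/allP => i si; exact: (@leq_bigmax_seq _ s xpredT id i).
  apply: (ideal_sub idealI (B := ~` ramification T s `|` [set k | (k <= n)%N])).
    move=> k _; case: (leqP k n) => nk'; first by right.
    left => /= Tk; apply: (nk k) => _; split => //.
    by apply: sub_all ns => i /= ni; lia.
  apply: (ideal_setU idealI); first exact: ramT.
  apply: (ideal_finite idealI); apply: (@sub_finite_set _ _ `I_n.+1) => //.
have [e eP] := choice ext.
pose S m := iter m (fun s => rcons s (e s)) [::].
pose b m := e (S m).
have SE m : S m = mkseq b m.
  by elim: m => //= m IH; rewrite mkseqS -IH.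
have Tb : is_branch T b.
  by apply: branch_of_prefixes => m; rewrite -SE => Tm; have [] := eP _ Tm.
have TS m : T (S m) by rewrite SE; case: m => [|m]; [exact: tree_nil|exact: Tb].
have incr i j : (i < j)%N -> (b i < b j)%N.
  move=> ij; have [_ /allP] := eP _ (TS j); apply.
  by rewrite SE; apply/mapP; exists i => //; rewrite mem_iota; lia.
exists (range b); last exact: branchT.
apply/infiniteP; rewrite (card_le_eqr (inj_card_eq _))//.
move=> i j _ _ bij; case: (ltngtP i j) => // /incr; lia.
Qed.

(** Everything that the nodes of size and labels bounded by n forbid: these
    are finitely many nodes, so the set is in the ideal. *)
Definition blocked n : set nat := [set k | (k <= n)%N \/
  exists s, [/\ (size s <= n.+1)%N, all (leq^~ n) s & T s /\ ~ T (rcons s k)]].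

Lemma blocked_ideal n : I (blocked n).
Proof.
apply: (ideal_setU idealI).
  by apply: (ideal_finite idealI); apply: (@sub_finite_set _ _ `I_n.+1).
apply: (ideal_bounded_seq_union _ _ idealI (F := fun s => [set k | T s /\ ~ T (rcons s k)])).
move=> s; have [Ts|nTs] := pselect (T s).
  by apply: (ideal_sub idealI) (ramT Ts) => k [].
by apply: (ideal_sub idealI) (ideal_finite idealI (finite_set0 _)) => k [].
Qed.

Lemma blocked_exists k : exists n, `[< blocked n k >].
Proof. by exists k; apply/asboolP; left => /=. Qed.

Definition rank k := ex_minn (blocked_exists k).

Lemma rankP k n : (n < rank k)%N -> ~ blocked n k.
Proof.
rewrite /rank; case: ex_minnP => m _ mmin nm sn.
by have := mmin n; rewrite asboolT// => /(_ isT); lia.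
Qed.

Lemma blocked_rank k : blocked (rank k) k.
Proof. by rewrite /rank; case: ex_minnP => m /asboolP. Qed.

Definition toWR k := (rank k, k).

Lemma toWR_vertical n : I (toWR @^-1` vertical_line n).
Proof.
by apply: (ideal_sub idealI) (blocked_ideal n) => k /= <-; exact: blocked_rank.
Qed.

(** Enumerate the sparse set by increasing rank.  The next point has rank above
    the sum of rank and value of each earlier one, hence above all labels of
    the list obtained so far, and at least its length because the ranks grow.
    So this list does not block it: the enumeration is a branch. *)
Lemma toWR_sparse G : WR_sparse G -> I (toWR @^-1` G).
Proof.
move=> sparseG; pose K := [set k | G (toWR k) /\ (0 < rank k)%N].
suff IK : I K.
  apply: (ideal_sub idealI (B := K `|` blocked 0)).
    move=> k Gk; case: (posnP (rank k)) => rk; last by left.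
    by right; rewrite -rk; exact: blocked_rank.
  by apply: (ideal_setU idealI) => //; exact: blocked_ideal.
have [/(ideal_finite idealI)//|infK] := pselect (finite_set K).
have sep k l : K k -> K l -> k <> l -> (rank l + l < rank k)%N \/ (rank k + k < rank l)%N.
  by move=> [Gk _] [Gl _] kl; apply: (sparseG _ _ Gk Gl) => -[_].
have injK k l : K k -> K l -> rank k = rank l -> k = l.
  by move=> Kk Kl rkl; apply: contrapT => /(sep _ _ Kk Kl); lia.
(* the next point of K after level c *)
have next c : exists k, [/\ K k, (c <= rank k)%N &
    forall l, K l -> (c <= rank l)%N -> (rank k <= rank l)%N].
  have [k0 [Kk0 ck0]] : exists k, K k /\ (c <= rank k)%N.
    apply: contrapT => /forallNP small; apply: infK.
    have : finite_set (rank @` K).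
      apply: (@sub_finite_set _ _ `I_c) => // _ [k Kk <-] /=.
      by rewrite ltnNge; apply/negP => ck; apply: (small k).
    apply: card_le_finite; rewrite (card_le_eqr (inj_card_eq _))//.
    by move=> k l; rewrite !inE; exact: injK.
  have ex : exists n, `[< exists k, [/\ K k, (c <= rank k)%N & rank k = n] >].
    by exists (rank k0); apply/asboolP; exists k0.
  case: (ex_minnP ex) => n /asboolP[k [Kk ck rk]] nmin.
  exists k; split => // l Kl cl; rewrite rk; apply: nmin; apply/asboolP.
  by exists l.
have [nx nxP] := choice next.
pose c m := iter m (fun c => (rank (nx c)).+1) 0%N.
pose b m := nx (c m).
have Kb m : K (b m) by have [] := nxP (c m).
have cb m : (c m <= rank (b m))%N by have [] := nxP (c m).
have cS m : c m.+1 = (rank (b m)).+1 by [].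
have mc m : (m <= c m)%N by elim: m => // m IH; rewrite cS; have := cb m; lia.
have mono i j : (i < j)%N -> (rank (b i) < rank (b j))%N.
  elim: j => // j IH; rewrite ltnS leq_eqVlt => /predU1P[->|/IH h];
  by have := cb j.+1; rewrite cS; lia.
have bT : is_branch T b.
  apply: branch_of_prefixes => m Tm; apply: contrapT => nT.
  have r0 : (0 < rank (b m))%N by have [] := Kb m.
  apply: (@rankP (b m) (rank (b m)).-1); first lia.
  right; exists (mkseq b m); rewrite size_mkseq; split => //.
    by have := mc m; have := cb m; lia.
  apply/allP => _ /mapP[l lm ->]; rewrite mem_iota in lm.
  have lt := mono l m ltac:(lia).
  have /(sep _ _ (Kb l) (Kb m)) : b l <> b m by move=> e; rewrite e in lt; lia.
  by move=> []; lia.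
apply: (ideal_sub idealI) (branchT bT) => k Kk.
have : exists2 l, (l < (rank k).+1)%N & b l = k.
  (* the enumeration reaches k before step rank k + 1, as c m >= m *)
  suff : forall m, (exists2 l, (l < m)%N & b l = k) \/ (c m <= rank k)%N.
    by move=> /(_ (rank k).+1) [//|]; have := mc (rank k).+1; lia.
  elim=> [|m [[l lm bl]|cm]]; first by right.
    by left; exists l => //; lia.
  have [_ _ /(_ k Kk cm)] := nxP (c m); rewrite -/(b m) leq_eqVlt => /predU1P[e|lt].
    by left; exists m => //; exact: injK.
  by right; rewrite cS.
by move=> [l _ <-]; exists l.
Qed.

(** The graph map k |-> (rank k, k) leaves infinitely many points uncovered.
    Redefining it on an infinite B in the ideal as a bijection onto what the
    rest does not cover only enlarges preimages by a subset of B. *)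
Lemma bij_le_WR_of_tree : bij_le WR I.
Proof.
have [B infB IB] := tree_infinite_set.
pose C := ~` (toWR @` ~` B).
have infC : infinite_set C.
  apply: (@sub_infinite_set _ ((fun k => ((rank k).+1, k)) @` setT)).
    by move=> _ [k _ <-] [l _] [rkl lk]; move: rkl; rewrite lk; lia.
  apply/infiniteP; rewrite (card_le_eqr (inj_card_eq _))//.
  by move=> i j _ _ [].
have : (B #= C)%card.
  by apply: card_eq_trans (eq_card_nat _ infB) _ => //;
    apply/card_esym/eq_card_nat.
move=> /card_set_bijP[h [hBC hinj hsurj]].
pose g k := if k \in B then h k else toWR k.
have gB k : B k -> g k = h k by move=> Bk; rewrite /g mem_set.
have gNB k : ~ B k -> g k = toWR k by move=> Bk; rewrite /g memNset.
have gbij : bijective g.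
  rewrite -setTT_bijective; split=> //.
    move=> i j _ _; have [Bi|Bi] := pselect (B i); have [Bj|Bj] := pselect (B j).
    - by rewrite !gB//; apply: hinj; rewrite inE.
    - rewrite gB// gNB// => e; case: (hBC _ Bi); rewrite e.
      by exists j.
    - rewrite gNB// gB// => e; case: (hBC _ Bj); rewrite -e.
      by exists i.
    - by rewrite !gNB// => -[_].
  move=> y _; have [[k nBk <-]|Cy] := pselect ((toWR @` ~` B) y).
    by exists k => //; rewrite gNB.
  by have [k Bk <-] := hsurj y Cy; exists k => //; rewrite gB.
have gI A : I (toWR @^-1` A) -> I (g @^-1` A).
  move=> IA; apply: (ideal_sub idealI) (ideal_setU idealI IB IA) => k /=.
  by have [Bk|Bk] := pselect (B k); [left|rewrite gNB//; right].
exists g => //; apply: (WR_generated idealI) => [n|G Gsp]; apply: gI.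
  exact: toWR_vertical.
exact: toWR_sparse.
Qed.

End TreeToWR.

Lemma bij_le_WR_of_not_weakly_Ramsey (I : set (set nat)) : is_ideal I ->
  ~ weakly_Ramsey I -> bij_le WR I.
Proof.
move=> idealI nwR; apply: contrapT => nb; apply: nwR => T treeT ramT.
apply: contrapT => nbr; apply: nb; apply: (bij_le_WR_of_tree idealI treeT ramT).
by move=> b bT; apply: contrapT => nI; apply: nbr; exists b.
Qed.

Lemma WR_vertical n : WR (vertical_line n).
Proof.
exists [set vertical_line n]; split; [exact: finite_set1| |].
  by move=> _ ->; left; exists n.
by move=> p np; exists (vertical_line n).
Qed.

Lemma WR_of_sparse G : WR_sparse G -> WR G.
Proof.
move=> sG; exists [set G]; split; [exact: finite_set1| |].
  by move=> _ ->; right.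
by move=> p np; exists G.
Qed.

(** Sequences whose images move strictly beyond the sum of coordinates of all
    earlier images form a tree; a finite sequence excludes only finitely many
    vertical lines from its ramification, and branches have sparse image. *)
Lemma not_katetov_le_WR (Y : Type) (I : set (set Y)) : is_ideal I ->
  weakly_Ramsey I -> ~ katetov_le WR I.
Proof.
move=> idealI wR [f fI].
pose far p q := ((f p).1 + (f p).2 < (f q).1)%N.
have If0 : I set0 by apply: (ideal_finite idealI).
have Ifar p : I [set q | ~~ far p q].
  apply: (ideal_sub idealI (B := [set q | exists2 n,
      (n <= (f p).1 + (f p).2)%N & (f @^-1` vertical_line n) q])).
    by move=> q; rewrite /= /far -leqNgt => qp; exists (f q).1.
  by apply: ideal_bounded_union => // n _; apply: fI; exact: WR_vertical.
have Iall s : I [set q | ~~ all (far^~ q) s].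
  elim: s => [|p s IH]; first by apply: (ideal_sub idealI) If0 => q.
  apply: (ideal_sub idealI) (ideal_setU idealI (Ifar p) IH) => q /=.
  by rewrite negb_and => /orP.
have [|s Ts|b bT] := wR [set s | pairwise far s].
- by split; [exists [::]|move=> s t /=; rewrite pairwise_cat => /and3P[]].
- apply: (ideal_sub idealI) (Iall s) => q /= nT; apply/negP => qs; apply: nT.
  by rewrite /ramification/= pairwise_rcons qs.
- apply; apply: (ideal_sub idealI (B := f @^-1` (f @` range b))).
    by move=> _ [k _ <-] /=; exists (b k) => //; exists k.
  apply: fI; apply: WR_of_sparse.
  have farb i j : (i < j)%N -> far (b i) (b j).
    case: j => // j ij; have : pairwise far (mkseq b j.+2) := bT j.+1.
    rewrite mkseqS pairwise_rcons => /andP[+ _].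
    by rewrite all_map => /allP/(_ i); apply; rewrite mem_iota; lia.
  move=> _ _ [_ [i _ <-] <-] [_ [j _ <-] <-]; case: (ltngtP i j) => [/farb|/farb|->] //.
    by right.
  by left.
Qed.

(** * Analytic ideals and countable pi-bases *)

Definition agree (T : Type) (n : nat) (x y : nat -> T) : Prop :=
  forall m, (m < n)%N -> x m = y m.

(** Sequential form of closedness in the product of two sequence spaces over
    discrete alphabets. *)
Definition cyl_closed (S T : Type) (C : (nat -> S) -> (nat -> T) -> Prop) : Prop :=
  forall x y,
    (forall n, exists x' y', [/\ agree n x x', agree n y y' & C x' y']) -> C x y.

Definition analytic (S : Type) (B : set (nat -> S)) : Prop :=
  exists2 C : (nat -> S) -> (nat -> nat) -> Prop, cyl_closed C &
    B = [set x | exists y, C x y].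

(** The first term of the witness tells which set of the union is meant. *)
Lemma analytic_bigcup S (B : nat -> set (nat -> S)) :
  (forall k, analytic (B k)) -> analytic (\bigcup_k B k).
Proof.
move=> anB; have /choice[C CP] : forall k, exists C : (nat -> S) -> (nat -> nat) -> Prop,
    cyl_closed C /\ B k = [set x | exists y, C x y].
  by move=> k; have [C] := anB k; exists C.
exists (fun x y => C (y 0%N) x (fun n => y n.+1)).
  move=> x y cl; have [clC _] := CP (y 0%N); apply: clC => n.
  have [x' [y' [xx' yy' Cxy']]] := cl n.+1.
  exists x', (fun n => y' n.+1); split => [m mn|m mn|].
  - by apply: xx'; lia.
  - by apply: yy'.
  - by rewrite (yy' 0%N).
apply/seteqP; split => x.
  move=> [k _]; have [_ ->] := CP k; move=> [y Cy].
  by exists (fun n => if n is m.+1 then y m else k).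
by move=> [y Cy]; exists (y 0%N) => //; have [_ ->] := CP (y 0%N); exists (fun n => y n.+1).
Qed.

(** A single sequence codes witnesses for all the sets at once through a
    pairing; closedness survives because finitely many terms of a row occur
    below some finite position of the code. *)
Lemma analytic_bigcap S (B : nat -> set (nat -> S)) :
  (forall k, analytic (B k)) -> analytic (\bigcap_k B k).
Proof.
move=> anB; have /choice[C CP] : forall k, exists C : (nat -> S) -> (nat -> nat) -> Prop,
    cyl_closed C /\ B k = [set x | exists y, C x y].
  by move=> k; have [C] := anB k; exists C.
pose row (y : nat -> nat) (k n : nat) := y (pickle (k, n)).
exists (fun x y => forall k, C k x (row y k)).
  move=> x y cl k; have [clC _] := CP k; apply: clC => n.
  pose N := (n + \max_(m < n) (pickle (k, m : nat)).+1)%N.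
  have [x' [y' [xx' yy' Cxy']]] := cl N.
  exists x', (row y' k); split => // m mn; first by apply: xx'; rewrite /N; lia.
  apply: yy'; apply: leq_trans (leq_addl _ _).
  exact: (@leq_bigmax 'I_n (fun m => (pickle (k, m : nat)).+1) (Ordinal mn)).
apply/seteqP; split => x.
  move=> Bx; have /choice[y yP] : forall k, exists y, C k x y.
    by move=> k; have := Bx k I; have [_ ->] := CP k.
  exists (fun p => if unpickle p is Some kn then y kn.1 kn.2 else 0%N) => k.
  have -> // : row (fun p => if unpickle p is Some kn then y kn.1 kn.2 else 0%N) k = y k.
  by apply/funext => n; rewrite /row pickleK.
by move=> [y Cy] k _; have [_ ->] := CP k; exists (row y k).
Qed.

Lemma agree_sym T n (x y : nat -> T) : agree n x y -> agree n y x.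
Proof. by move=> xy m /xy. Qed.

Lemma agree_trans T n (x y z : nat -> T) : agree n x y -> agree n y z -> agree n x z.
Proof. by move=> xy yz m mn; rewrite xy// yz. Qed.

Lemma agreeW T n m (x y : nat -> T) : (n <= m)%N -> agree m x y -> agree n x y.
Proof. by move=> nm xy k kn; apply: xy; lia. Qed.

Lemma analytic_open S (B : set (nat -> S)) :
  (forall x, B x -> exists n, forall x', agree n x x' -> B x') -> analytic B.
Proof.
move=> openB.
exists (fun x y => forall x', agree (y 0%N) x x' -> B x').
  move=> x y cl x' xx'; have [x1 [y1 [xx1 yy1]]] := cl (y 0%N).+1; apply.
  rewrite -(yy1 0%N)//; apply: agree_trans xx'.
  by apply: agree_sym; exact: agreeW xx1.
apply/seteqP; split => x; first by move=> /openB[n nP]; exists (fun=> n).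
by move=> [y]; apply.
Qed.

Lemma analytic_closed S (B : set (nat -> S)) :
  (forall x, ~ B x -> exists n, forall x', agree n x x' -> ~ B x') -> analytic B.
Proof.
move=> clB; exists (fun x y => B x).
  move=> x y cl; apply: contrapT => /clB[n nP].
  by have [x' [_ [xx' _]]] := cl n; exact: nP.
by apply/seteqP; split => x; [exists (fun=> 0%N)|case].
Qed.

Lemma open_cantor_cylinder (U : set cantor_space) (x : cantor_space) : open U -> U x ->
  exists n, forall x' : cantor_space, agree n x x' -> U x'.
Proof.
move=> oU Ux; apply: contrapT => /forallNP noc.
have /choice[z zP] : forall n, exists x' : cantor_space, agree n x x' /\ ~ U x'.
  move=> n; apply: contrapT => /forallNP h; apply: (noc n) => x' xx'.
  by apply: contrapT => nU; apply: (h x').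
have zx : z @ \oo --> x.
  apply/cvg_sup => i V [_ [[A oA <-] /= Ax]] /filterS; apply.
  by exists i.+1 => // n /= /(proj1 (zP n)) <-.
have [n _ /(_ n (leqnn n))] := zx _ (open_nbhs_nbhs (conj oU Ux)).
by have [] := zP n.
Qed.

(** Analytic sets with analytic complement form a sigma-algebra containing the
    open sets. *)
Lemma borel_analytic (B : set cantor_space) :
  <<s @open cantor_space >> B -> analytic (B : set (nat -> bool)).
Proof.
move=> borB.
suff : analytic (B : set (nat -> bool)) /\ analytic (~` B : set (nat -> bool)) by case.
apply: (smallest_sub (X := [set B : set cantor_space |
  analytic (B : set (nat -> bool)) /\ analytic (~` B : set (nat -> bool))])) borB.
  split => /=.
  - split; first by apply: analytic_open.
    by rewrite setC0; apply: analytic_open => x _; exists 0%N.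
  - by move=> A [aA aCA]; rewrite setTD setCK.
  - move=> A aA; rewrite setC_bigcup; split.
      by apply: analytic_bigcup => k; have [] := aA k.
    by apply: analytic_bigcap => k; have [] := aA k.
move=> U oU; split.
  by apply: analytic_open => x Ux; exact: open_cantor_cylinder.
apply: analytic_closed => x; rewrite /setC/= notK => Ux.
have [n nP] := open_cantor_cylinder oU Ux.
by exists n => x' /nP Ux' /(_ Ux').
Qed.

(** Equivalently, every set of the dual filter contains a member of F, which
    makes F a pi-base of that filter; the members need not be in the filter,
    only positive. *)
Definition has_positive_pi_base (I : set (set nat)) : Prop :=
  exists2 F : nat -> set nat, (forall j, ~ I (F j)) &
    forall A, I A -> exists j, F j `&` A = set0.

Section Dichotomy.
Context (I : set (set nat)) (idealI : is_ideal I).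
Variable C : (nat -> bool) -> (nat -> nat) -> Prop.
Hypothesis clC : cyl_closed C.
Hypothesis IE : forall A : set nat, I A <-> exists y, C (fun n => `[< A n >]) y.

(* A witness interleaves the digits of a set of the ideal, which is to contain A,
   with a sequence for which the closed relation C holds. *)
Local Notation W := (bool * nat)%type.

(** Asking for a superset of A rather than A itself makes witnesses inherited
    by subsets; the second player may then drop some of his moves. *)
Definition witnesses (A : set nat) (w : nat -> W) : Prop :=
  C (fst \o w) (snd \o w) /\ forall k, A k -> (w k).1.

(** The position (s, t) of the closed game is not yet lost for the first player,
    s being the numbers chosen by the second and t the digits of the witness. *)
Definition plausible (s : seq nat) (t : seq W) : Prop :=
  exists w, [/\ C (fst \o w) (snd \o w), mkseq w (size t) = t &
    forall k, k \in s -> (k < size t)%N -> (w k).1].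

Lemma witnessesP A : I A <-> exists w, witnesses A w.
Proof.
split=> [/IE[y Cy]|[w [Cw Aw]]].
  exists (fun n => (`[< A n >], y n)); split => // k Ak /=; exact/asboolP.
apply: (ideal_sub idealI Aw); apply/IE; exists (snd \o w).
congr C : Cw; apply/funext => n /=.
by apply/idP/asboolP.
Qed.

Lemma plausible_witnesses A w :
  (forall s n, (forall k, k \in s -> A k) -> plausible s (mkseq w n)) ->
  witnesses A w.
Proof.
move=> pl; split.
  apply: clC => n; have [w' [Cw']] := pl [::] n (fun k => ltac:(by [])).
  rewrite size_mkseq => /(congr1 (nth (w 0%N))) ww' _.
  have {}ww' m : (m < n)%N -> w m = w' m.
    by move=> mn; have := congr1 (@^~ m) ww'; rewrite !nth_mkseq.
  by exists (fst \o w'), (snd \o w'); split => // m mn /=; rewrite ww'.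
move=> k Ak; have [w' [Cw']] := pl [:: k] k.+1 ltac:(by move=> l; rewrite inE => /eqP ->).
rewrite size_mkseq => /(congr1 (fun s => nth (w 0%N) s k)); rewrite !nth_mkseq// => <-.
by apply; rewrite ?inE.
Qed.

(** A countable pi-base restricted to the sets A and witnesses compatible with
    the position (s, t); solved positions replace those won by the second
    player. *)
Definition solved (s : seq nat) (t : seq W) : Prop :=
  exists2 F : nat -> set nat, (forall j, ~ I (F j)) &
    forall A w, witnesses A w -> (forall k, k \in s -> A k) ->
      mkseq w (size t) = t -> exists j, F j `&` A = set0.

Lemma solved_implausible s t : ~ plausible s t -> solved s t.
Proof.
move=> np; exists (fun=> setT); first by move=> _; exact: ideal_proper idealI.
move=> A w [Cw Aw] sA wt; exfalso; apply: np; exists w; split => // k /sA Ak _.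
exact: Aw.
Qed.

(** Add to the families of the solved successors the positive sets S u of
    solving answers to the digit u.  A compatible set disjoint from no S u
    meets the one for the next digit of its witness, and the corresponding
    successor takes over. *)
Lemma solved_step s t :
  (forall u, ~ I [set k | solved (rcons s k) (rcons t u)]) -> solved s t.
Proof.
move=> pos; pose S u := [set k | solved (rcons s k) (rcons t u)].
have /choice[G GP] : forall p : W * nat, exists F : nat -> set nat, (forall j, ~ I (F j)) /\
    (S p.1 p.2 -> forall A w, witnesses A w -> (forall k, k \in rcons s p.2 -> A k) ->
      mkseq w (size (rcons t p.1)) = rcons t p.1 -> exists j, F j `&` A = set0).
  move=> [u k] /=; have [[F F1 F2]|nS] := pselect (S u k); first by exists F.
  by exists (fun=> setT); split => // _; exact: ideal_proper idealI.
pose F (j : nat) : set nat := match (unpickle j : option (W + (W * nat) * nat)) with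
  | Some (inl u) => S u | Some (inr (p, i)) => G p i | None => setT end.
exists F.
  move=> j; rewrite /F; case: unpickle => [[u|[p i]]|]; first exact: pos.
    by have [] := GP p.
  exact: ideal_proper idealI.
move=> A w wA sA wt; pose u := w (size t).
have [disj|] := eqVneq (S u `&` A) set0.
  by exists (pickle (inl u : W + (W * nat) * nat)); rewrite /F pickleK.
move=> /set0P[k [Sk Ak]]; have [_ /(_ Sk A w wA)] := GP (u, k); case.
- by move=> l; rewrite mem_rcons inE => /predU1P[->|/sA].
- by rewrite /= size_rcons mkseqS wt.
- by move=> i iP; exists (pickle (inr ((u, k), i) : W + (W * nat) * nat)); rewrite /F pickleK.
Qed.

(** If the initial position is not solved, [solved_step] lets the first player
    keep positions unsolved, hence plausible, by forbidding sets of the ideal: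
    a tree whose branches have a witness for being in the ideal. *)
Lemma weakly_Ramsey_pi_base : weakly_Ramsey I -> has_positive_pi_base I.
Proof.
move=> wR; have [[F F1 F2]|nsol] := pselect (solved [::] [::]).
  exists F => // A /witnessesP[w wA]; exact: (F2 A w).
have next s t : exists u, ~ solved s t -> I [set k | solved (rcons s k) (rcons t u)].
  apply: contrapT => /forallNP nu; apply: (nu (true, 0%N)) => ns; exfalso.
  by apply: ns; apply: solved_step => u Iu; apply: (nu u).
have /choice[e eP] : forall st : seq nat * seq W, exists u, ~ solved st.1 st.2 ->
    I [set k | solved (rcons st.1 k) (rcons st.2 u)].
  by move=> [s t]; exact: next.
(* the position reached when the second player plays s and the first follows e *)
pose resp := foldl (fun (st : seq nat * seq W) k => (rcons st.1 k, rcons st.2 (e st))) ([::], [::]).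
have resp1 s : (resp s).1 = s.
  by elim/last_ind: s => // s k IH; rewrite /resp foldl_rcons /= -/(resp s) IH.
have respS s k : (resp (rcons s k)).2 = rcons (resp s).2 (e (resp s)).
  by rewrite /resp foldl_rcons.
pose T := [set s | forall n, ~ solved (take n s) (resp (take n s)).2].
have [||b bT nI] := wR T.
- split; first by exists [::].
  move=> s t Tst n; have [ns|sn] := leqP n (size s).
    by have := Tst n; rewrite takel_cat.
  by have := Tst (size s); rewrite take_size_cat// take_oversize//; lia.
- move=> s Ts; have nsol_s : ~ solved s (resp s).2 by have := Ts (size s); rewrite take_size.
  have := eP (resp s); rewrite resp1 => /(_ nsol_s).
  apply: (ideal_sub idealI) => k /= /existsNP[n /contrapT].
  have [ns|sn] := leqP n (size s); first by rewrite -cats1 takel_cat// => /(Ts n).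
  by rewrite take_oversize ?size_rcons// respS.
exfalso; apply: nI.
pose w n := e (resp (mkseq b n)).
have respE n : (resp (mkseq b n)).2 = mkseq w n.
  by elim: n => // n IH; rewrite !mkseqS respS IH.
have pl n : plausible (mkseq b n) (mkseq w n).
  apply: contrapT => /solved_implausible; rewrite -respE.
  by have := bT n n; rewrite mkseqS -cats1 takel_cat ?size_mkseq// take_oversize ?size_mkseq.
apply/witnessesP; exists w; apply: plausible_witnesses => s n sb.
(* a later position of the branch contains s and at least n digits *)
have [N [nN sN]] : exists N, (n <= N)%N /\ {subset s <= mkseq b N}.
  elim: s sb => [|k s IH] sb; first by exists n.
  have [N [nN sN]] := IH (fun l ls => sb l ltac:(by rewrite inE ls orbT)).
  have [i _ bi] := sb k (mem_head _ _).
  exists (maxn N i.+1); split; first lia.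
  move=> l; rewrite inE => /predU1P[->|/sN].
    by rewrite -bi; apply/mapP; exists i => //; rewrite mem_iota; lia.
  move=> /mapP[j]; rewrite mem_iota => jN ->.
  by apply/mapP; exists j => //; rewrite mem_iota; lia.
have [w' [Cw' ww' w's]] := pl N; rewrite size_mkseq in ww' w's.
exists w'; rewrite size_mkseq; split => //.
  have := congr1 (take n) ww'; rewrite /mkseq -!map_take take_iota.
  by rewrite (minn_idPl nN).
by move=> k ks kn; apply: w's; [exact: sN|lia].
Qed.

End Dichotomy.

Lemma borel_weakly_Ramsey_pi_base (I : set (set nat)) : is_ideal I ->
  borel_ideal I -> weakly_Ramsey I -> has_positive_pi_base I.
Proof.
move=> idealI /borel_analytic[C clC BE].
apply: (weakly_Ramsey_pi_base idealI clC) => A.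
have := congr1 (@^~ (fun n => `[< A n >])) BE => /= <-.
suff -> : [set n | `[< A n >]] = A by [].
by apply/seteqP; split => n /= /asboolP.
Qed.

(** * Ideal limits of quasi-continuous functions are cliquish *)

Definition cliquish (R : realType) (X : topologicalType) (f : X -> R) : Prop :=
  forall (e : R) (U : set X), 0 < e -> open U -> U !=set0 ->
    exists V : set X, [/\ open V, V !=set0, V `<=` U &
      forall x y, V x -> V y -> `|f x - f y| < e].

Lemma baire_somewhere_dense (X : topologicalType) (A : nat -> set X) (U : set X) :
  baire_space X -> open U -> U !=set0 -> U `<=` \bigcup_j A j ->
  exists j V, [/\ open V, V !=set0, V `<=` U & V `<=` closure (A j)].
Proof.
move=> baireX oU U0 UA; apply: contrapT => /forallNP nd.
have [] := baireX (fun j => ~` closure (A j `&` U)) _ U U0 oU.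
  move=> j; split; first by apply: closed_openC; exact: closed_closure.
  move=> O [z Oz] oO; apply: contrapT => nO.
  have OcA : O `<=` closure (A j `&` U).
    by move=> x Ox; apply: contrapT => nx; apply: nO; exists x.
  apply: (nd j); exists (O `&` U); split.
  - exact: openI.
  - have [x [[_ Ux] Ox]] := OcA z Oz O (open_nbhs_nbhs (conj oO Oz)).
    by exists x.
  - by move=> x [].
  - by move=> x [/OcA + _]; apply: closure_subset => y [].
move=> x [Ux nA]; have [j _ Aj] := UA x Ux.
by apply: (nA j) => //; apply: subset_closure.
Qed.

(** The sets A j of points where all g_i with i in F j are within d of f cover
    the space, so one is dense in some open V.  On a smaller V' one of these
    g_i varies little, hence all of them do, first on A j and then everywhere
    on V' by quasi-continuity.  Finally f is close to some of them at each
    point, F j being positive. *)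
Lemma ideal_limit_cliquish (R : realType) (I : set (set nat)) (X : topologicalType)
    (f : X -> R) :
  is_ideal I -> has_positive_pi_base I -> baire_space X ->
  ideal_LIM I (QC R X) f -> cliquish f.
Proof.
move=> idealI [F posF baseF] baireX [g gQC gf] e U e0 oU U0.
(* f stays within 5d of a constant on V', so it oscillates by at most 10d *)
pose d := e / 12.
have d0 : 0 < d by rewrite /d; lra.
pose A j := [set x | forall i, F j i -> `|g i x - f x| < d].
have UA : U `<=` \bigcup_j A j.
  move=> x _; have [j Fj] := baseF _ (gf x d d0); exists j => // i Fi.
  rewrite ltNge; apply/negP => ge; suff : set0 i by [].
  by rewrite -Fj; split.
have [j [V [oV V0 VU VA]]] := baire_somewhere_dense baireX oU U0 UA.
have [i0 Fi0] : exists i, F j i.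
  apply: contrapT => /forallNP nF; apply: (posF j).
  apply: (ideal_sub idealI (B := set0)) => [i /nF//|].
  exact: (ideal_finite idealI (finite_set0 _)).
have [x0 Vx0] := V0.
have [V' [oV' V'0 V'V V'g]] := gQC i0 d x0 V d0 oV Vx0.
exists V'; split => //; first exact: subset_trans V'V VU.
pose r := g i0 x0.
have gr i z : F j i -> V' z -> `|g i z - r| < 4 * d.
  move=> Fi V'z; have [W [oW [w Ww] WV' Wg]] := gQC i d z V' d0 oV' V'z.
  have [y [Ay Wy]] : exists y, A j y /\ W y.
    have [y [Ay Wy]] := VA w (V'V _ (WV' _ Ww)) W (open_nbhs_nbhs (conj oW Ww)).
    by exists y.
  have := Wg y Wy; have := V'g y (WV' _ Wy); have := Ay i Fi; have := Ay i0 Fi0.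
  rewrite -/r !ltr_norml => /andP[? ?] /andP[? ?] /andP[? ?] /andP[? ?].
  by apply/andP; split; lra.
have fr z : V' z -> `|f z - r| < 5 * d.
  move=> V'z; have [i [Fi giz]] : exists i, F j i /\ `|g i z - f z| < d.
    apply: contrapT => /forallNP nF; apply: (posF j).
    apply: (ideal_sub idealI) (gf z d d0) => i Fi /=.
    by rewrite leNgt; apply/negP => lt; apply: (nF i).
  have := gr i z Fi V'z; move: giz.
  rewrite !ltr_norml => /andP[? ?] /andP[? ?].
  by apply/andP; split; lra.
move=> x y /fr + /fr; rewrite /d !ltr_norml => /andP[? ?] /andP[? ?].
by apply/andP; split; lra.
Qed.

Lemma finite_ideal_is_ideal : is_ideal (@finite_set nat).
Proof.
split.
- by move=> A B; exact: sub_finite_set.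
- by move=> A B finA finB; rewrite finite_setU.
- exact: infinite_nat.
- by [].
Qed.

Lemma finite_ideal_pi_base : has_positive_pi_base (@finite_set nat).
Proof.
exists (fun j => [set n | (j <= n)%N]).
  move=> j finj; apply: infinite_nat.
  apply: (@sub_finite_set _ _ (`I_j `|` [set n | (j <= n)%N])).
    by move=> n _; case: (ltnP n j); [left|right].
  by rewrite finite_setU.
move=> A /finite_seqP[s ->]; exists (\max_(i <- s) i).+1.
apply/seteqP; split => n // [/= sn ns].
have le_n : (n <= \max_(i <- s) i)%N := @leq_bigmax_seq _ s xpredT id n ns isT.
by move: (leq_trans sn le_n); rewrite ltnn.
Qed.

Lemma ideal_cvg_of_cvg (R : realType) (I : set (set nat)) (u : nat -> R) l :
  is_ideal I -> u i @[i --> \oo] --> l -> ideal_cvg I u l.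
Proof.
move=> idealI /cvgrPdist_lt ul e e0; have [N _ NP] := ul e e0.
apply: (ideal_finite idealI); apply: (@sub_finite_set _ _ `I_N) => // i /= ei.
rewrite ltnNge; apply/negP => Ni; have := NP i Ni.
by rewrite /= distrC ltNge ei.
Qed.

Lemma LIM_sub_ideal_LIM (R : realType) (I : set (set nat)) (X : Type)
    (F : set (X -> R)) : is_ideal I -> LIM F `<=` ideal_LIM I F.
Proof.
move=> idealI f [g gF gf]; exists g => // x.
by apply: ideal_cvg_of_cvg => //; exact: gf.
Qed.

(** Ordinary convergence is convergence along the ideal of finite sets, for which
    the final segments are a positive pi-base. *)
Lemma LIM_cliquish (R : realType) (X : topologicalType) (f : X -> R) :
  baire_space X -> LIM (QC R X) f -> cliquish f.
Proof.
move=> baireX fL; apply: (ideal_limit_cliquish finite_ideal_is_ideal) => //.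
  exact: finite_ideal_pi_base.
exact: (LIM_sub_ideal_LIM finite_ideal_is_ideal).
Qed.

(** * Cliquish functions are limits of quasi-continuous functions *)

Lemma metric_refl (R : realType) (X : Type) (d : X -> X -> R) x :
  is_metric d -> d x x = 0.
Proof. by case=> _ /(_ x x)[_ ->]. Qed.

Section MetricNets.
Context (R : realType) (X : topologicalType) (d : X -> X -> R).
Hypothesis metric_d : is_metric d.
Hypothesis open_d : forall U : set X, open U <->
  forall x, U x -> exists2 e : R, 0 < e & [set y | d x y < e] `<=` U.

Let d_ge0 x y : 0 <= d x y. Proof. by case: metric_d. Qed.
Let d_eq0 x y : d x y = 0 <-> x = y. Proof. by case: metric_d. Qed.
Let dxx x : d x x = 0. Proof. exact: metric_refl. Qed.
Let dC x y : d x y = d y x. Proof. by case: metric_d. Qed.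
Let d_tri x y z : d x z <= d x y + d y z. Proof. by case: metric_d. Qed.

Lemma open_metric_ball x e : open [set y | d x y < e].
Proof.
apply/open_d => y /= xy; exists (e - d x y); first by rewrite subr_gt0.
by move=> z /= yz; have := d_tri x y z; lra.
Qed.

Lemma closure_meets (A U : set X) x : closure A x -> open U -> U x ->
  exists2 y, A y & U y.
Proof. by move=> clA oU Ux; have [y []] := clA U (open_nbhs_nbhs (conj oU Ux)); exists y. Qed.

(** Zorn's lemma: a maximal separated subset is a net. *)
Lemma maximal_separated (S : set X) (e : R) : 0 < e ->
  exists E : set X, [/\ E `<=` S, (forall x y, E x -> E y -> d x y < e -> x = y) &
    forall x, S x -> exists2 y, E y & d x y < e].
Proof.
move=> e0; pose P (E : set X) := E `<=` S /\ (forall x y, E x -> E y -> d x y < e -> x = y).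
have [|E [[ES sepE] maxE]] := @Zorn_bigcup X P.
  move=> F FP tot; split; first by move=> x [E FE Ex]; have [+ _] := FP E FE; apply.
  move=> x y [E FE Ex] [E' FE' E'y].
  have [EE'|E'E] := tot E E' FE FE'.
    by have [_] := FP E' FE'; apply => //; exact: EE'.
  by have [_] := FP E FE; apply => //; exact: E'E.
exists E; split => // x Sx; apply: contrapT => far.
have farE y : E y -> d x y < e -> False by move=> Ey xy; apply: far; exists y.
apply: (maxE (E `|` [set x])).
  split; last by move=> h; apply: (farE x); [apply: h; right|rewrite dxx].
  by move=> y Ey; left.
split; first by move=> y [/ES|->].
move=> y z [Ey|->] [Ez|->] //; first exact: sepE.
  by rewrite dC => /farE; move=> /(_ Ey).
by move=> /farE; move=> /(_ Ez).
Qed.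

Definition isolated_at (P : set X) (x : X) : Prop :=
  exists2 r : R, 0 < r & forall y, P y -> d x y < r -> y = x.

Lemma isolated_at_separated (P : set X) e x : 0 < e ->
  (forall x y, P x -> P y -> d x y < e -> x = y) -> isolated_at P x.
Proof.
move=> e0 sepP; have [[y [Py xy yx]]|none] :=
    pselect (exists y, [/\ P y, d x y < e / 2 & y <> x]).
  have dxy : 0 < d x y.
    rewrite lt_neqAle d_ge0 andbT eq_sym; apply/eqP => /d_eq0 xy0.
    by apply: yx.
  exists (d x y) => // z Pz xz; exfalso.
  suff yz : y = z by rewrite yz ltxx in xz.
  by apply: sepP => //; have := d_tri y x z; rewrite (dC y x); lra.
exists (e / 2); first by lra.
by move=> y Py xy; apply: contrapT => yx; apply: none; exists y.
Qed.

Lemma isolated_atU (P Q : set X) x : isolated_at P x -> isolated_at Q x ->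
  isolated_at (P `|` Q) x.
Proof.
move=> [r r0 rP] [s s0 sQ]; exists (Num.min r s); first by rewrite lt_min r0.
by move=> y [Py|Qy]; rewrite lt_min => /andP[? ?]; [exact: rP|exact: sQ].
Qed.

Variable N : set X.
Hypothesis closedN : closed N.
Hypothesis nowhere_denseN : forall z (e : R), 0 < e -> exists2 x, ~ N x & d z x < e.

Let off_N x : ~ N x -> exists2 r, 0 < r & forall y, d x y < r -> ~ N y.
Proof.
move=> Nx; have oN : open (~` N) by apply: closed_openC.
by have [r r0 rN] := (open_d _).1 oN x Nx; exists r.
Qed.

Section OpenSets.
Variables (M : nat -> set X) (eps : nat -> R).
Hypothesis MN : forall k, M k `<=` N.
Hypothesis eps_gt0 : forall k, 0 < eps k.
Hypothesis eps_small : forall r : R, 0 < r -> exists K, forall k, (K <= k)%N -> eps k < r.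

(** Near the closed nowhere dense set N, choose a net of each M k by points off
    N, at scale eps k and off the earlier nets.  Each net is separated and
    hence isolated at every point, N included, so that the later ones still
    find room; and as the scales tend to 0, only finitely many nets come near
    a given point off N. *)
Lemma disjoint_nets : exists E : nat -> set X, [/\
  forall k x, E k x -> ~ N x /\ exists2 z, M k z & d z x < eps k,
  forall j k x, E j x -> E k x -> j = k,
  forall k z, M k z -> exists2 x, E k x & d z x < 2 * eps k &
  forall x, ~ N x -> isolated_at (\bigcup_k E k) x].
Proof.
pose S k (P : set X) := [set x | [/\ ~ N x, ~ P x & exists2 z, M k z & d z x < eps k]].
have /choice[mx mxP] : forall kP : nat * set X, exists E : set X,
    [/\ E `<=` S kP.1 kP.2, (forall x y, E x -> E y -> d x y < eps kP.1 -> x = y) &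
    forall x, S kP.1 kP.2 x -> exists2 y, E y & d x y < eps kP.1].
  by move=> [k P]; exact: maximal_separated.
pose P := fix P k := if k is j.+1 then P j `|` mx (j, P j) else set0.
pose E k := mx (k, P k).
have ES k x : E k x -> S k (P k) x by have [+ _ _] := mxP (k, P k); apply.
have sepE k x y : E k x -> E k y -> d x y < eps k -> x = y.
  by have [_ + _] := mxP (k, P k); apply.
have maxE k x : S k (P k) x -> exists2 y, E k y & d x y < eps k.
  by have [_ _] := mxP (k, P k); apply.
have PS k : P k.+1 = P k `|` E k by [].
have PN k x : P k x -> ~ N x.
  elim: k => // k IH; rewrite PS => -[//|/ES[]//].
have isoP k x : isolated_at (P k) x.
  elim: k => [|k IH]; first by exists 1.
  by rewrite PS; apply: isolated_atU => //; exact: isolated_at_separated (eps_gt0 k) (sepE k).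
have EP j k : (j < k)%N -> E j `<=` P k.
  elim: k => // k IH; rewrite ltnS leq_eqVlt PS => /predU1P[->|/IH jk] x Ex.
    by right.
  by left; exact: jk.
exists E; split.
- by move=> k x /ES[].
- move=> j k x Ej Ek; case: (ltngtP j k) => // jk.
    by have [_ + _] := ES _ _ Ek; case; exact: EP jk _ Ej.
  by have [_ + _] := ES _ _ Ej; case; exact: EP jk _ Ek.
- move=> k z Mz; have [r r0 rP] := isoP k z.
  have [x Nx] : exists2 x, ~ N x & d z x < Num.min r (eps k).
    by apply: nowhere_denseN; rewrite lt_min r0 eps_gt0.
  rewrite lt_min => /andP[zr ze].
  have Sx : S k (P k) x.
    split => //; last by exists z.
    by move=> Px; apply: Nx; rewrite (rP x Px zr); exact: MN Mz.
  have [y Ey xy] := maxE k x Sx; exists y => //.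
  by have := d_tri z x y; lra.
- move=> x Nx; have [r r0 rN] := off_N Nx.
  have [K KP] : exists K, forall k, (K <= k)%N -> eps k < r / 2.
    by apply: eps_small; lra.
  have [s s0 sP] := isoP K x.
  exists (Num.min s (r / 2)); first by rewrite lt_min s0; lra.
  move=> y [k _ Ey]; rewrite lt_min => /andP[xs xr].
  have [kK|Kk] := ltnP k K; first by apply: sP => //; exact: EP kK _ Ey.
  exfalso; have [_ _ [z Mz zy]] := ES _ _ Ey.
  apply: (rN z); last exact: MN Mz.
  by have := d_tri x y z; rewrite (dC y z); have := KP k Kk; lra.
Qed.

(** Small balls around the points of the nets: with radius at most half the
    isolation radius of the centre they are disjoint. *)
Lemma disjoint_accumulating_open_sets : exists W : nat -> set X, [/\
  forall k, open (W k),
  forall k x, W k x -> ~ N x,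
  forall j k x, W j x -> W k x -> j = k,
  forall k x, W k x -> exists2 z, M k z & d x z < 2 * eps k &
  forall k z, M k z -> exists2 x, W k x & d z x < 2 * eps k].
Proof.
have [E [EN Edisj EM Eiso]] := disjoint_nets.
have /choice[rad radP] : forall e, exists r : R, (\bigcup_k E k) e ->
    [/\ 0 < r, forall y, (\bigcup_k E k) y -> d e y < r -> y = e &
    forall y, d e y < r -> ~ N y].
  move=> e; have [[k _ Ee]|nE] := pselect ((\bigcup_k E k) e); last by exists 0.
  have [Ne _] := EN k e Ee.
  have [r r0 rE] := Eiso e Ne; have [s s0 sN] := off_N Ne.
  exists (Num.min r s) => _; split; first by rewrite lt_min r0.
    by move=> y Ey; rewrite lt_min => /andP[? _]; exact: rE.
  by move=> y; rewrite lt_min => /andP[_]; exact: sN.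
have radE k e : E k e -> [/\ 0 < rad e, forall y j, E j y -> d e y < rad e -> y = e &
    forall y, d e y < rad e -> ~ N y].
  move=> Ee; have [|r0 rE rN] := radP e; first by exists k.
  by split => // y j Ey; apply: rE; exists j.
pose W k := [set x | exists2 e, E k e & d e x < Num.min (rad e / 2) (eps k)].
exists W; split.
- move=> k; rewrite (_ : W k = \bigcup_(e in E k) [set x | d e x < Num.min (rad e / 2) (eps k)]).
    by apply: bigcup_open => e _; exact: open_metric_ball.
  by apply/seteqP; split => x [e Ee ex]; exists e.
- move=> k x [e Ee]; rewrite lt_min => /andP[ex _].
  have [r0 _] := radE k e Ee; apply; lra.
- move=> j k x [e Ee]; rewrite lt_min => /andP[ex _] [e' Ee'].
  rewrite lt_min => /andP[ex' _]; apply: (Edisj j k e) => //.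
  have [r0 rE _] := radE j e Ee; have [r0' rE' _] := radE k e' Ee'.
  have tri := d_tri e x e'; rewrite (dC x e') in tri.
  have [le|lt] := leP (rad e) (rad e').
    suff -> : e = e' by [].
    by apply: (rE' _ j Ee); rewrite dC; lra.
  suff <- : e' = e by [].
  by apply: (rE _ k Ee'); lra.
- move=> k x [e Ee]; rewrite lt_min => /andP[_ ex].
  have [_ [z Mz ze]] := EN k e Ee; exists z => //.
  by have := d_tri x e z; rewrite (dC x e) (dC e z); lra.
- move=> k z Mz; have [e Ee ze] := EM k z Mz; exists e => //.
  have [r0 _ _] := radE k e Ee.
  by exists e => //; rewrite dxx lt_min eps_gt0 andbT; lra.
Qed.

End OpenSets.

Lemma open_avoid_closed (C : nat -> set X) K : (forall k, closed (C k)) ->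
  open [set x | forall k, (k < K)%N -> ~ C k x].
Proof.
move=> clC; elim: K => [|K IH].
  by rewrite (_ : [set x | _] = setT); [exact: openT|apply/seteqP; split].
rewrite (_ : [set x | _] = [set x | forall k, (k < K)%N -> ~ C k x] `&` ~` C K).
  by apply: openI => //; exact: closed_openC.
apply/seteqP; split => x.
  by move=> h; split; [move=> k kK; apply: h; lia|exact: h].
move=> [h nK] k; rewrite ltnS leq_eqVlt => /predU1P[->//|]; exact: h.
Qed.

(** Off N the family W is locally finite, since the sets W k are confined to
    shrinking neighbourhoods of N. *)
Lemma closure_bigcup_locally_finite (W : nat -> set X) (eps : nat -> R) x :
  (forall r : R, 0 < r -> exists K, forall k, (K <= k)%N -> eps k < r) ->
  (forall k y, W k y -> exists2 z, N z & d y z < eps k) ->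
  ~ N x -> closure (\bigcup_k W k) x -> exists k, closure (W k) x.
Proof.
move=> eps_small WN Nx clx; apply: contrapT => /forallNP nW.
have [r r0 rN] := off_N Nx.
have [K KP] : exists K, forall k, (K <= k)%N -> eps k < r / 2.
  by apply: eps_small; lra.
have oO := open_avoid_closed K (fun k => @closed_closure _ (W k)).
have [|y [k _ Wy] [yO]] := closure_meets clx (openI oO (open_metric_ball x (r / 2))).
  by split => /=; [move=> k _; exact: nW|rewrite dxx; lra].
move=> /= xy; have [kK|Kk] := ltnP k K.
  by apply: (yO k kK); exact: subset_closure.
have [z Nz yz] := WN k y Wy; apply: (rN z) => //.
by have := d_tri x y z; have := KP k Kk; lra.
Qed.

End MetricNets.

(** An enumeration of the rationals repeating each value infinitely often:
    the 2-adic valuation of k + 1 takes every value infinitely often. *)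
Definition dense_values (R : realType) (k : nat) : R :=
  if (unpickle (logn 2 k.+1) : option rat) is Some s then ratr s else 0.

Lemma dense_valuesP (R : realType) (r e : R) K : 0 < e ->
  exists2 k, (K <= k)%N & `|r - dense_values R k| < e.
Proof.
move=> e0; have lt_re : r - e < r + e by lra.
have [s] := rat_in_itvoo lt_re; rewrite in_itv /= => /andP[s1 s2].
exists ((2 ^ pickle s * K.*2.+1).-1).
  have := expn_gt0 2 (pickle s); nia.
rewrite /dense_values prednK ?muln_gt0 ?expn_gt0// lognM ?expn_gt0// pfactorK//.
rewrite (_ : logn 2 K.*2.+1 = 0%N) ?addn0 ?pickleK.
  by rewrite ltr_norml; apply/andP; split; lra.
by rewrite lognE dvdn2 /= odd_double.
Qed.

Section CliquishLimit.
Context (R : realType) (X : topologicalType) (d : X -> X -> R).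
Hypothesis metric_d : is_metric d.
Hypothesis open_d : forall U : set X, open U <->
  forall x, U x -> exists2 e : R, 0 < e & [set y | d x y < e] `<=` U.
Variable f : X -> R.
Hypothesis cliquish_f : cliquish f.

Definition small_osc (e : R) : set X := [set x | exists V : set X,
  [/\ open V, V x & forall y z, V y -> V z -> `|f y - f z| < e]].

Lemma open_small_osc e : open (small_osc e).
Proof.
rewrite openE => x [V [oV Vx Ve]].
apply: (filterS _ (open_nbhs_nbhs (conj oV Vx))) => y Vy.
by exists V.
Qed.

Lemma small_osc_dense z (e r : R) : 0 < e -> 0 < r -> exists2 x, small_osc e x & d z x < r.
Proof.
move=> e0 r0; have [|V [oV [x Vx] VB Ve]] := cliquish_f e0 (open_metric_ball metric_d open_d z r).
  by exists z; rewrite /= metric_refl.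
by exists x; [exists V|exact: VB].
Qed.

(** Let N be the set of points of large oscillation.  Keep f on N.  Near N use
    disjoint open sets W k with constant value q k, each near points of N where
    f is close to q k, and such that every value of f on N is approximated on
    sets W k accumulating at the point.  Elsewhere f is locally close to
    a rational; take q j for the least j such that x is adherent to the open
    set G j where f is near q j.  In both cases a value is attained on open
    sets adherent to the point, which is quasi-continuity. *)
Lemma quasi_continuous_approx (e : R) : 0 < e -> exists2 g : X -> R, quasi_continuous g &
  forall x, (~ small_osc e x /\ g x = f x) \/
    (small_osc e x /\ exists2 z, d x z < e & `|g x - f z| < 3 * e).
Proof.
move=> e0; pose N := ~` small_osc e.
have closedN : closed N by apply: open_closedC; exact: open_small_osc.
have ndN z (r : R) : 0 < r -> exists2 x, ~ N x & d z x < r.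
  move=> r0; have [x sx zx] := small_osc_dense z e0 r0.
  by exists x => // nx; exact: nx sx.
pose q := @dense_values R.
pose M k := [set z | N z /\ `|f z - q k| < e].
pose eps k : R := e / 4 / k.+1%:R.
have eps_gt0 k : 0 < eps k by rewrite /eps !divr_gt0.
have eps_lee k : eps k <= e / 4.
  by rewrite /eps ler_pdivrMr ?ltr0n// ler_peMr ?ler1n//; lra.
have eps_small (r : R) : 0 < r -> exists K, forall k, (K <= k)%N -> eps k < r.
  move=> r0; exists (Num.truncn (e / 4 / r)) => k Kk.
  rewrite /eps ltr_pdivrMr ?ltr0n// [X in _ < X]mulrC -ltr_pdivrMr//.
  by apply: lt_le_trans (truncnS_gt _) _; rewrite ler_nat.
have MN k : M k `<=` N by move=> z [].
have [W [oW WN Wdisj WM MW]] := disjoint_accumulating_open_sets metric_d open_d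
  closedN ndN MN eps_gt0 eps_small.
pose G j := [set x | exists V : set X, [/\ open V, V x & forall y, V y -> `|f y - q j| < 2 * e]].
have oG j : open (G j).
  rewrite openE => x [V [oV Vx Ve]].
  by apply: (filterS _ (open_nbhs_nbhs (conj oV Vx))) => y Vy; exists V.
(* closures rather than the sets themselves: a boundary point takes the value of
   an adjacent piece *)
pose onW x v := exists2 k, closure (W k) x & v = q k.
pose onG x v := (forall k, ~ closure (W k) x) /\ exists j, [/\ closure (G j) x,
  forall i, (i < j)%N -> ~ closure (G i) x & v = q j].
have /choice[g gP] : forall x, exists v, (N x -> v = f x) /\ (~ N x -> onW x v \/ onG x v).
  move=> x; have [Nx|Nx] := pselect (N x); first by exists (f x).
  have [[k clk]|nW] := pselect (exists k, closure (W k) x).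
    by exists (q k); split => // _; left; exists k.
  have [V [oV Vx Ve]] : small_osc e x by apply: contrapT.
  have [j0 _ fj0] := dense_valuesP (f x) 0 e0.
  have exj : exists j, `[< closure (G j) x >].
    exists j0; apply/asboolP; apply: subset_closure; exists V; split => // y Vy.
    have := Ve y x Vy Vx; move: fj0; rewrite -/(q j0) !ltr_norml => /andP[? ?] /andP[? ?].
    by apply/andP; split; lra.
  case: (ex_minnP exj) => j /asboolP clj jmin.
  exists (q j); split => // _; right; split; first by move=> k clk; apply: nW; exists k.
  exists j; split => // i ij cli; have := jmin i (asboolT cli).
  by rewrite leqNgt ij.
have gN x : N x -> g x = f x by have [] := gP x.
have gW k x : W k x -> g x = q k.
  move=> Wx; have [_ /(_ (WN _ _ Wx))] := gP x.
  move=> [[l cll ->]|[/(_ k) + _]]; last by case; exact: subset_closure.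
  have [y Wly Wky] := closure_meets cll (oW k) Wx.
  by rewrite (Wdisj l k y).
exists g.
  move=> r x U r0 oU Ux.
  have [Nx|Nx] := pselect (N x).
    have [s s0 sU] := (open_d U).1 oU x Ux.
    have [K KP] : exists K, forall k, (K <= k)%N -> eps k < s / 2 by apply: eps_small; lra.
    have [k Kk] := @dense_valuesP R (f x) (Num.min r e) K ltac:(by rewrite lt_min r0).
    rewrite -/(q k) lt_min => /andP[fr fe].
    have [y Wy xy] := MW k x (conj Nx fe).
    exists (W k `&` U); split.
    - exact: openI.
    - by exists y; split => //; apply: sU => /=; have := KP k Kk; lra.
    - by move=> z [].
    - by move=> z [Wz _]; rewrite (gW k z Wz) (gN x Nx) distrC.
  have [_ /(_ Nx)[[k clk gx]|[nW [j [clj nclj gx]]]]] := gP x.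
    have [y Wy Uy] := closure_meets clk oU Ux.
    exists (W k `&` U); split.
    - exact: openI.
    - by exists y.
    - by move=> z [].
    - by move=> z [Wz _]; rewrite (gW k z Wz) gx subrr normr0.
  have eps2_small (s : R) : 0 < s -> exists K, forall k, (K <= k)%N -> 2 * eps k < s.
    move=> s0; have [|K KP] := eps_small (s / 2); first by lra.
    by exists K => k /KP; lra.
  have WN2 k y : W k y -> exists2 z, N z & d y z < 2 * eps k.
    by move=> /WM[z [Nz _] yz]; exists z.
  pose O := ~` N `&` ~` closure (\bigcup_k W k) `&`
    [set x | forall i, (i < j)%N -> ~ closure (G i) x] `&` U.
  have oO : open O.
    apply: openI => //; apply: openI.
      by apply: openI; apply: closed_openC => //; exact: closed_closure.
    by apply: open_avoid_closed => i; exact: closed_closure.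
  have Ox : O x.
    split => //; split => //; split => //.
    move=> clx; have [k /nW//] := closure_bigcup_locally_finite metric_d open_d closedN
      eps2_small WN2 Nx clx.
  have [y Gy Oy] := closure_meets clj oO Ox.
  exists (G j `&` O); split.
  - by apply: openI.
  - by exists y.
  - by move=> z [_ []].
  - move=> z [Gz [[[nNz nWz] nGz] _]].
    have [_ /(_ nNz)[[k clk _]|[_ [i [cli ncli ->]]]]] := gP z.
      by case: nWz; apply: closure_subset clk => w Ww; exists k.
    suff -> : i = j by rewrite gx subrr normr0.
    case: (ltngtP i j) => // ij; first by case: (nGz i ij).
    by case: (ncli j ij); exact: subset_closure.
move=> x; have [Nx|Nx] := pselect (N x); first by left; split => //; exact: gN.
right; have sx : small_osc e x by apply: contrapT.
split => //; have [_ /(_ Nx)[[k clk ->]|[_ [j [clj _ ->]]]]] := gP x.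
  have e2 : 0 < e / 2 by lra.
  have xx : [set y | d x y < e / 2] x by rewrite /= metric_refl.
  have [y Wy xy] := closure_meets clk (open_metric_ball metric_d open_d x (e / 2)) xx.
  have [z [_ fz] yz] := WM k y Wy; exists z.
    have [_ _ _ /(_ x y z)] := metric_d; move: xy => /=; have := eps_lee k; lra.
  by rewrite distrC (lt_trans fz)//; lra.
have [V [oV Vx Ve]] := sx.
have [y [V' [oV' V'y V'e]] Vy] := closure_meets clj oV Vx.
exists x; first by rewrite metric_refl.
have := V'e y V'y; have := Ve y x Vy Vx.
rewrite !ltr_norml => /andP[? ?] /andP[? ?].
by apply/andP; split; lra.
Qed.

Lemma small_oscS (e e' : R) : e <= e' -> small_osc e `<=` small_osc e'.
Proof.
move=> ee' x [V [oV Vx Ve]]; exists V; split => // y z Vy Vz.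
exact: lt_le_trans (Ve y z Vy Vz) ee'.
Qed.

(** Apply [quasi_continuous_approx] at scales tending to 0.  A point of
    discontinuity is eventually in the set where f is kept; at a point of
    continuity the approximations are close to values of f nearby. *)
Lemma cliquish_LIM : LIM (QC R X) f.
Proof.
pose e n : R := n.+1%:R^-1.
have e0 n : 0 < e n by rewrite /e invr_gt0.
have e_anti m n : (m <= n)%N -> e n <= e m.
  by move=> mn; rewrite /e lef_pV2 ?posrE ?ltr0n// ler_nat.
have e_small (r : R) : 0 < r -> exists n, e n < r.
  move=> r0; exists (Num.truncn r^-1).
  by rewrite /e invf_plt ?posrE// truncnS_gt.
have /choice[g gP] : forall n, exists g : X -> R, quasi_continuous g /\
  forall x, (~ small_osc (e n) x /\ g x = f x) \/
    (small_osc (e n) x /\ exists2 z, d x z < e n & `|g x - f z| < 3 * e n).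
  by move=> n; have [g gqc gn] := quasi_continuous_approx (e0 n); exists g.
exists g; first by move=> n; have [] := gP n.
move=> x; have [[m nm]|osc] := pselect (exists m, ~ small_osc (e m) x).
  apply: (@cvg_trans _ (f x @[_ --> \oo])); last exact: cvg_cst.
  apply: near_eq_cvg; exists m => // n /= mn.
  have [_ /(_ x)[[_ ->//]|[sx _]]] := gP n.
  by case: nm; apply: small_oscS sx; exact: e_anti.
have {}osc n : small_osc (e n) x by apply: contrapT => ns; apply: osc; exists n.
apply/cvgrPdist_lt => r r0.
have [m em] : exists n, e n < r / 2 by apply: e_small; lra.
have [V [oV Vx Ve]] := osc m.
have [s s0 sV] := (open_d V).1 oV x Vx.
have [K eK] : exists n, e n < Num.min s (r / 6).
  by apply: e_small; rewrite lt_min s0; lra.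
exists K => // n /= Kn; have en := le_lt_trans (e_anti K n Kn) eK.
move: en; rewrite lt_min => /andP[es er].
have [_ /(_ x)[[]|[_ [z xz gz]]]] := gP n; first by have := osc n.
have Vz : V z by apply: sV => /=; lra.
have := Ve x z Vx Vz; move: gz; rewrite !ltr_norml => /andP[? ?] /andP[? ?].
by apply/andP; split; lra.
Qed.

End CliquishLimit.

(** * A space where the ideal WR adds limits *)

(** A copy of the function type that carries the topology of cylinders. *)
Definition seq_space (T : Type) : Type := nat -> T.

HB.instance Definition _ (T : Type) := gen_eqMixin (seq_space T).
HB.instance Definition _ (T : Type) := gen_choiceMixin (seq_space T).

Section SeqSpace.
Variable T : Type.
Local Notation X := (seq_space T).

Definition cyl_open (U : set X) : Prop :=
  forall x, U x -> exists n, forall y : X, agree n x y -> U y.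

Lemma cyl_openT : cyl_open setT.
Proof. by move=> x _; exists 0%N. Qed.

Lemma cyl_openI : setI_closed cyl_open.
Proof.
move=> A B oA oB x [Ax Bx]; have [n nP] := oA x Ax; have [m mP] := oB x Bx.
exists (maxn n m) => y xy; split; [apply: nP|apply: mP]; apply: agreeW xy; lia.
Qed.

Lemma cyl_open_bigcup (J : Type) (f : J -> set X) :
  (forall i, cyl_open (f i)) -> cyl_open (\bigcup_i f i).
Proof.
move=> of_ x [i _ fx]; have [n nP] := of_ i x fx.
by exists n => y /nP fy; exists i.
Qed.

HB.instance Definition _ := isOpenTopological.Build (seq_space T)
  cyl_openT cyl_openI cyl_open_bigcup.

Lemma seq_openE (U : set X) : open U = cyl_open U.
Proof. by []. Qed.

Lemma open_cylinder (x : X) n : open [set y : X | agree n x y].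
Proof.
rewrite seq_openE => y xy; exists n => z yz; exact: agree_trans xy yz.
Qed.

Lemma seq_space_baire : baire_space X.
Proof.
move=> U oU O [x0 Ox0] oO.
have step k (s : X * nat) : exists s' : X * nat, [/\ (s.2 < s'.2)%N, agree s.2 s.1 s'.1 &
    forall y : X, agree s'.2 s'.1 y -> U k y].
  case: s => x n /=; have [oUk dUk] := oU k.
  have cyl0 : [set y : X | agree n x y] !=set0 by exists x.
  have [y [xy Uy]] := dUk _ cyl0 (@open_cylinder x n).
  have [m mP] := oUk y Uy; exists (y, maxn n.+1 m); split => //=; first lia.
  by move=> z yz; apply: mP; apply: agreeW yz; lia.
have /choice[nx nxP] : forall ks : nat * (X * nat), exists s' : X * nat,
    [/\ (ks.2.2 < s'.2)%N, agree ks.2.2 ks.2.1 s'.1 &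
    forall y : X, agree s'.2 s'.1 y -> U ks.1 y] by move=> [k s]; exact: step.
have [n0 n0P] := oO x0 Ox0.
pose s := fix s k := if k is j.+1 then nx (j, s j) else (x0, n0).
have sS k : [/\ ((s k).2 < (s k.+1).2)%N, agree (s k).2 (s k).1 (s k.+1).1 &
    forall y : X, agree (s k.+1).2 (s k.+1).1 y -> U k y] by exact: (nxP (k, s k)).
have le_s k : (k <= (s k).2)%N by elim: k => // k IH; have [] := sS k; lia.
have agr k l : (k <= l)%N -> ((s k).2 <= (s l).2)%N /\ agree (s k).2 (s k).1 (s l).1.
  elim: l => [|l IH]; first by rewrite leqn0 => /eqP ->.
  rewrite leq_eqVlt ltnS => /predU1P[->//|/IH[kl akl]].
  have [ll all_ _] := sS l; split; first lia.
  by apply: agree_trans akl _; exact: agreeW all_.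
pose z : X := fun m => (s m.+1).1 m.
have zk k : agree (s k).2 (s k).1 z.
  move=> m mk; rewrite /z; have [km|mk'] := leqP k m.+1.
    by have [_] := agr _ _ km; apply.
  by have [_ ->//] := agr m.+1 k (ltnW mk'); have := le_s m.+1; lia.
exists z; split; first by apply: n0P; exact: (zk 0%N).
by move=> k _; have [_ _] := sS k; apply; exact: zk.
Qed.

Variable R : realType.

Definition first_diff (x y : X) : R :=
  if pselect (exists m, `[< x m <> y m >]) is left h then (ex_minn h).+1%:R^-1 else 0.

Lemma first_diffP (x y : X) :
  (x = y /\ first_diff x y = 0) \/
  exists n, [/\ first_diff x y = n.+1%:R^-1, agree n x y & x n <> y n].
Proof.
rewrite /first_diff; case: pselect => [h|nh].
  right; case: ex_minnP => n /asboolP nP nmin; exists n; split => // m mn.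
  apply: contrapT => xy; have := nmin m; rewrite asboolT// => /(_ isT); lia.
left; split => //; apply/funext => m; apply: contrapT => xy; apply: nh.
by exists m; apply/asboolP.
Qed.

Lemma first_diff_ltE (x y : X) n : first_diff x y < n.+1%:R^-1 <-> agree n.+1 x y.
Proof.
have [[-> ->]|[k [-> kxy nxy]]] := first_diffP x y.
  by split => // _; rewrite invr_gt0 ltr0n.
rewrite ltf_pV2 ?posrE ?ltr0n// ltr_nat; split => [nk|nxy'].
  by apply: agreeW kxy; lia.
by rewrite ltnNge; apply/negP => kn; apply: nxy; apply: nxy'; lia.
Qed.

Lemma first_diff_ge0 (x y : X) : 0 <= first_diff x y.
Proof. by have [[_ ->]|[k [-> _ _]]] := first_diffP x y; rewrite ?invr_ge0. Qed.

Lemma seq_space_metrizable : metrizable R X.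
Proof.
exists first_diff.
  split.
  - exact: first_diff_ge0.
  - move=> x y; split=> [|<-]; last by have [[]|[k []]] := first_diffP x x.
    have [[-> //]|[k [-> _ _]]] := first_diffP x y.
    by move=> /eqP; rewrite invr_eq0 pnatr_eq0.
  - move=> x y; have [[-> //]|[k [-> kxy nxy]]] := first_diffP x y.
    have [[yx _]|[l [-> lyx nyx]]] := first_diffP y x; first by case: nxy; rewrite yx.
    by case: (ltngtP k l) => [/lyx e|/kxy e|->//]; [case: nxy|case: nyx].
  - move=> x y z; have [[_ ->]|[k [-> _ nxz]]] := first_diffP x z.
      by apply: addr_ge0; exact: first_diff_ge0.
    have [xy|yx] := ltP (first_diff x y) k.+1%:R^-1; last first.
      by rewrite (le_trans yx)// lerDl first_diff_ge0.
    have [yz|zy] := ltP (first_diff y z) k.+1%:R^-1; last first.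
      by rewrite (le_trans zy)// lerDr first_diff_ge0.
    move: xy yz => /first_diff_ltE xy /first_diff_ltE yz.
    by case: nxz; apply: (agree_trans xy yz).
move=> U; rewrite seq_openE; split=> oU x Ux.
  have [n nP] := oU x Ux; exists n.+1%:R^-1; first by rewrite invr_gt0 ltr0n.
  by move=> y /= /first_diff_ltE xy; apply: nP; apply: agreeW xy.
have [e e0 eU] := oU x Ux.
exists (Num.truncn e^-1).+1 => y xy; apply: eU => /=.
apply: lt_trans (_ : (Num.truncn e^-1).+1%:R^-1 < e); first exact/first_diff_ltE.
by rewrite invf_plt ?posrE// truncnS_gt.
Qed.

End SeqSpace.

Local Notation Ledger := (seq_space (nat * nat)).

(** A sequence x of pairs is read as a record of points of the plane: the pair
    (a, j) at place p is a pause if a = 0, and otherwise records the point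
    (bound x p + a, j), where bound x p is the coordinate sum of the point
    recorded last.  So recorded points always form a sparse set, and any finite
    record may be followed by any sequence whatsoever. *)
Fixpoint bound (x : Ledger) (p : nat) : nat :=
  if p is q.+1 then
    if (x q).1 == 0%N then bound x q else (bound x q + (x q).1 + (x q).2)%N
  else 0%N.

Definition hit (x : Ledger) (i j : nat) : Prop :=
  exists p, [/\ (0 < (x p).1)%N, (bound x p + (x p).1)%N = i & (x p).2 = j].

(** The second alternative says that the record is finite and that (i, j) may
    still be appended; long pauses make such x adherent to the open set of
    records of (i, j).  Otherwise the record of x has passed i already. *)
Definition hit_or_small (x : Ledger) (i j : nat) : Prop :=
  hit x i j \/ forall p, (bound x p < i)%N.

(** Each recorded point increases the bound, so these are the finite records. *)
Definition bounded_ledger (x : Ledger) : Prop := exists c, forall p, (bound x p < c)%N.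

Lemma bound_mono (x : Ledger) p q : (p <= q)%N -> (bound x p <= bound x q)%N.
Proof.
elim: q => [|q IH]; first by rewrite leqn0 => /eqP ->.
rewrite leq_eqVlt ltnS => /predU1P[->//|/IH pq] /=; case: ifP => _ //; lia.
Qed.

Lemma bound_agree (x y : Ledger) p : agree p x y -> bound x p = bound y p.
Proof.
elim: p => //= p IH xy; rewrite IH; last by apply: agreeW xy.
by rewrite (xy p).
Qed.

Lemma hit_agree (x y : Ledger) p i j : agree p.+1 x y -> (0 < (x p).1)%N ->
  (bound x p + (x p).1)%N = i -> (x p).2 = j -> hit y i j.
Proof.
move=> xy x0 xi xj; have e := xy p (ltnSn p).
by exists p; rewrite -e -(@bound_agree x)//; apply: agreeW xy.
Qed.

Lemma hit_sparse (x : Ledger) : WR_sparse [set ij | hit x ij.1 ij.2].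
Proof.
have lt_hit p q i j k l : (p < q)%N ->
    (0 < (x p).1)%N -> (bound x p + (x p).1)%N = i -> (x p).2 = j ->
    (0 < (x q).1)%N -> (bound x q + (x q).1)%N = k -> (x q).2 = l -> (i + j < k)%N.
  move=> pq p0 pi pj q0 qk ql; have := bound_mono x pq; rewrite /=.
  by rewrite (gtn_eqF p0); lia.
move=> [i j] [k l] [p [p0 pi pj]] [q [q0 qk ql]] ne /=.
case: (ltngtP p q) => pq.
- by right; exact: (lt_hit p q _ _ _ l).
- by left; exact: (lt_hit q p _ _ _ j).
- by case: ne; move: pi pj qk ql; rewrite /= pq => <- <- <- <-.
Qed.

Lemma WR_sub A B : A `<=` B -> WR B -> WR A.
Proof.
by move=> AB [F [finF FG BF]]; exists F; split => //; exact: subset_trans AB BF.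
Qed.

Lemma WR_bounded c : WR [set ij | (ij.1 <= c)%N].
Proof.
exists (vertical_line @` `I_c.+1); split.
- exact: finite_image.
- by move=> _ [n _ <-]; left; exists n.
- by move=> ij ijc; exists (vertical_line ij.1) => //; exists ij.1.
Qed.

Section Counterexample.
Variable R : realType.

Definition hit_fun (ij : nat * nat) (x : Ledger) : R :=
  if `[< hit_or_small x ij.1 ij.2 >] then 1 else 0.

Definition bounded_fun (x : Ledger) : R := if `[< bounded_ledger x >] then 1 else 0.

(** Every cylinder around x contains a cylinder on which the predicate is constant
    with the value it has at x. *)
Lemma hit_fun_QC ij : quasi_continuous (hit_fun ij).
Proof.
case: ij => i j e x U e0 oU Ux.
have [n nP] : exists n, forall y : Ledger, agree n x y -> U y by exact: oU.
suff [y [m [nm xy gy]]] : exists (y : Ledger) m, [/\ (n <= m)%N, agree n x y &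
    forall z, agree m y z -> hit_or_small z i j <-> hit_or_small x i j].
  exists [set z : Ledger | agree m y z]; split.
  - exact: open_cylinder.
  - by exists y.
  - by move=> z yz; apply: nP; apply: agree_trans xy _; exact: agreeW yz.
  - by move=> z yz; rewrite /hit_fun/= (propext (gy z yz)) subrr normr0.
have [[[p [p0 pi pj]]|sm]|ns] := pselect (hit_or_small x i j).
- exists x, (maxn n p.+1); split => //; first lia.
  move=> z xz; split => _; left; first by exists p; split.
  by apply: (hit_agree _ p0 pi pj); apply: agreeW xz; lia.
- pose y : Ledger := fun m => if m == n then ((i - bound x n)%N, j) else x m.
  have xy : agree n x y by move=> m mn; rewrite /y ltn_eqF.
  exists y, n.+1; split => // z yz; split => _; first by right.
  have smn := sm n.
  left; apply: (hit_agree yz); rewrite /y eqxx//=; first lia.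
  by rewrite -(bound_agree xy); lia.
- have [p ip] : exists p, (i <= bound x p)%N.
    apply: contrapT => /forallNP h; apply: ns; right => p.
    by rewrite ltnNge; apply/negP => /h.
  exists x, (maxn n p); split => //; first lia.
  move=> z xz; split => // -[[q [q0 qi qj]]|]; last first.
    move=> /(_ p); rewrite -(@bound_agree x); last by apply: agreeW xz; lia.
    by rewrite ltnNge ip.
  have [pq|qp] := leqP p q.
    have := bound_mono z pq; rewrite -(@bound_agree x _ p); last by apply: agreeW xz; lia.
    by lia.
  left; apply: (hit_agree _ q0 qi qj).
  by apply: agree_sym; apply: agreeW xz; lia.
Qed.

(** The error set is a subset of the recorded points for an infinite record, and
    of finitely many vertical lines for a finite one. *)
Lemma hit_fun_cvg (x : Ledger) (e : R) : 0 < e ->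
  WR [set ij | e <= `|hit_fun ij x - bounded_fun x|].
Proof.
move=> e0; have [bx|nbx] := pselect (bounded_ledger x).
  have [c cP] := bx; apply: (@WR_sub _ [set ij | (ij.1 <= c)%N]); last exact: WR_bounded.
  move=> [i j] /=; rewrite /bounded_fun /hit_fun (asboolT bx).
  case: (leqP i c) => // ci; rewrite asboolT ?subrr ?normr0 1?leNgt ?e0//.
  by right=> p /=; have := cP p; lia.
apply: (WR_sub _ (WR_of_sparse (@hit_sparse x))) => -[i j] /=.
rewrite /bounded_fun /hit_fun (asboolF nbx); case: asboolP => [[//|sm]|_].
  by case: nbx; exists i.
by rewrite subrr normr0 leNgt e0.
Qed.

Lemma bounded_fun_not_cliquish : ~ cliquish bounded_fun.
Proof.
move=> /(_ 1 setT ltr01 openT (ex_intro _ (fun=> (0, 0)%N) Logic.I)).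
move=> [V [oV [x Vx] _ Vf]].
have [n nP] : exists n, forall y : Ledger, agree n x y -> V y by exact: oV.
pose y c : Ledger := fun m => if (m < n)%N then x m else (c, 0)%N.
have Vy c : V (y c) by apply: nP => m mn; rewrite /y mn.
have := Vf _ _ (Vy 1%N) (Vy 0%N); rewrite /bounded_fun.
rewrite [`[< bounded_ledger (y 1%N) >]]asboolF; last first.
  move=> [c cP]; suff : (c <= bound (y 1%N) (n + c))%N by have := cP (n + c)%N; lia.
  elim: {cP} c => // c IH; rewrite addnS /=.
  have -> : y 1%N (n + c)%N = (1, 0)%N by rewrite /y ltnNge leq_addr.
  by rewrite /=; lia.
rewrite asboolT ?sub0r ?normrN ?normr1 ?ltxx//.
exists (bound (y 0%N) n).+1 => p; rewrite ltnS.
have [pn|np] := leqP p n; first exact: bound_mono.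
elim: p np => // p IH; rewrite ltnS leq_eqVlt /= => /predU1P[<-|np].
  by have -> : y 0%N n = (0, 0)%N by rewrite /y ltnn.
by have -> : y 0%N p = (0, 0)%N by [rewrite /y ltnNge (ltnW np)]; exact: IH.
Qed.

End Counterexample.

(** * The equivalence *)

Theorem corollary1p7 (R : realType) (I : set (set nat))
    (idealI : is_ideal I) (borelI : borel_ideal I) :
  [<-> (forall X : topologicalType, metrizable R X -> baire_space X ->
          ideal_LIM I (QC R X) = LIM (QC R X));
       weakly_Ramsey I;
       ~ katetov_le WR I;
       ~ bij_le WR I].
Proof.
tfae.
- move=> limI; apply: contrapT => /(bij_le_WR_of_not_weakly_Ramsey idealI)[f _ fI].
  pose X : topologicalType := seq_space (nat * nat)%type.
  have bX : baire_space X by exact: seq_space_baire.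
  apply: (@bounded_fun_not_cliquish R); apply: (LIM_cliquish bX).
  rewrite -limI//; last exact: seq_space_metrizable.
  exists (fun k => hit_fun R (f k)); first by move=> k; exact: hit_fun_QC.
  by move=> x e e0; exact: fI (hit_fun_cvg x e0).
- exact: not_katetov_le_WR.
- by move=> nK [f _ fI]; apply: nK; exists f.
- move=> nb X metX bX; apply/seteqP; split; last exact: LIM_sub_ideal_LIM.
  have wR : weakly_Ramsey I.
    by apply: contrapT => /(bij_le_WR_of_not_weakly_Ramsey idealI).
  have pI := borel_weakly_Ramsey_pi_base idealI borelI wR.
  have [d metric_d open_d] := metX.
  move=> f fI; apply: (cliquish_LIM metric_d open_d).
  exact: ideal_limit_cliquish idealI pI bX fI.
Qed.
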